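(* Let $(M,d,X,C)$ be a metric coordinate system such that the metric space $(X,d_C)$ is locally compact. Let $V:(X,d_C)\to(TX,d_C^T)$ be a locally Lipschitz metric-coordinate vector field. Then $V$ has unique solutions.
   Context: A metric coordinate system is a quadruple $(M,d,X,C)$ where $(M,d)$ is a metric space, $X\subset M$, and $C\subset M$ is a metric coordinatizing set for $X$: for all $x,y\in X$ with $x\neq y$ there is $c\in C$ with $d(x,c)\neq d(y,c)$. For $x\in X$ and $c\in C$ write $x_c:=d(x,c)$. The metric $d_C$ on $X$ is $d_C(x,y):=\sup_{c\in C}|x_c-y_c|$ (finite since $|x_c-y_c|\le d(x,y)$). For a curve $\phi:[0,\delta)\to X$ ($\delta>0$) write $\phi_c(t):=d(\phi(t),c)$; its forward metric-coordinate derivative at $t$ is $\phi_C^+(t):=(\phi_c^+(t))_{c\in C}\in\mathbb{R}^C$, where $\phi_c^+(t):=\lim_{h\to0^+}\frac{\phi_c(t+h)-\phi_c(t)}{h}$, provided all these limits exist. Let $X^+$ be the set of curves $\phi:[0,\delta)\to X$ (any $\delta>0$), continuous with respect to $d_C$, for which $\phi_C^+(0)$ exists and $\sup_{c\in C}|\phi_c^+(0)|<\infty$. Define $\phi\sim\psi$ iff $\phi(0)=\psi(0)$ and $\phi_C^+(0)=\psi_C^+(0)$. The tangent bundle is $TX:=X^+/\!\sim$, and $T_xX$ is the set of classes $[\phi]$ with $\phi(0)=x$. The metric $d_C^T$ on $TX$ is $d_C^T([\phi],[\psi]):=\max\{d_C(\phi(0),\psi(0)),\ \sup_{c\in C}|\phi_c^+(0)-\psi_c^+(0)|\}$.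 A metric-coordinate vector field is a map $V:X\to TX$ with $V(x)\in T_xX$ for each $x\in X$. It is locally Lipschitz if $V:(X,d_C)\to(TX,d_C^T)$ is locally Lipschitz, i.e. every point has a $d_C$-neighborhood and a constant $K\ge0$ with $d_C^T(V(y),V(z))\le K\,d_C(y,z)$ for $y,z$ in that neighborhood. A solution to $V$ with initial condition $x\in X$ is a curve $\sigma:[0,\delta)\to X$ ($\delta>0$), continuous with respect to $d_C$, with $\sigma(0)=x$, such that for every $t\in[0,\delta)$ the forward metric-coordinate derivative $\sigma_C^+(t)$ exists and equals $\phi_C^+(0)$ for (any) $\phi\in V(\sigma(t))$. $V$ has unique solutions if for every $x\in X$ a solution $\sigma:[0,\delta)\to X$ with $\sigma(0)=x$ exists, and any other solution $\tau:[0,\epsilon)\to X$ with $\tau(0)=x$ satisfies $\tau(t)=\sigma(t)$ for all $t$ in the common domain. *)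

(* Defs.v *)
From Stdlib Require Import Reals List.
From Coquelicot Require Import Coquelicot.
Open Scope R_scope.

Definition is_metric {M : Type} (d : M -> M -> R) : Prop :=
  (forall x y, d x y = 0 <-> x = y) /\
  (forall x y, d x y = d y x) /\
  (forall x y z, d x z <= d x y + d y z).

Definition coordinatizing {M : Type} (d : M -> M -> R) (X C : M -> Prop) : Prop :=
  forall x y, X x -> X y -> x <> y -> exists c, C c /\ d x c <> d y c.

(* sup_{c in C} f c  (as a real number; the sets used below are bounded). *)
Definition supC {M : Type} (C : M -> Prop) (f : M -> R) : R :=
  real (Lub_Rbar (fun r => exists c, C c /\ r = f c)).

Definition dC {M : Type} (d : M -> M -> R) (C : M -> Prop) (x y : M) : R :=
  supC C (fun c => Rabs (d x c - d y c)).

Definition dC_open {M : Type} (d : M -> M -> R) (X C : M -> Prop) (U : M -> Prop) : Prop :=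
  (forall y, U y -> X y) /\
  forall y, U y -> exists eps, 0 < eps /\ forall z, X z -> dC d C y z < eps -> U z.

Definition dC_compact {M : Type} (d : M -> M -> R) (X C : M -> Prop) (K : M -> Prop) : Prop :=
  (forall y, K y -> X y) /\
  forall (I : Type) (U : I -> M -> Prop),
    (forall i, dC_open d X C (U i)) ->
    (forall k, K k -> exists i, U i k) ->
    exists l : list I, forall k, K k -> exists i, In i l /\ U i k.

Definition dC_locally_compact {M : Type} (d : M -> M -> R) (X C : M -> Prop) : Prop :=
  forall x, X x -> exists K r, dC_compact d X C K /\ 0 < r /\
    (forall y, X y -> dC d C x y < r -> K y).

Definition has_fwd_deriv (f : R -> R) (t l : R) : Prop :=
  forall eps, 0 < eps -> exists eta, 0 < eta /\
    forall h, 0 < h < eta -> Rabs ((f (t + h) - f t) / h - l) < eps.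

Definition curve_in {M : Type} (d : M -> M -> R) (X C : M -> Prop)
    (phi : R -> M) (delta : R) : Prop :=
  0 < delta /\
  (forall t, 0 <= t < delta -> X (phi t)) /\
  (forall t, 0 <= t < delta -> forall eps, 0 < eps -> exists eta, 0 < eta /\
      forall s, 0 <= s < delta -> Rabs (s - t) < eta -> dC d C (phi s) (phi t) < eps).

Definition in_Xplus {M : Type} (d : M -> M -> R) (X C : M -> Prop)
    (phi : R -> M) (delta : R) : Prop :=
  curve_in d X C phi delta /\
  exists w : M -> R,
    (forall c, C c -> has_fwd_deriv (fun t => d (phi t) c) 0 (w c)) /\
    exists B, forall c, C c -> Rabs (w c) <= B.

(* A tangent vector [phi] in TX is represented by its base point phi(0) and its
   metric-coordinate derivative phi_C^+(0) (a function on C).  A vector field V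
   assigns to x the coordinate vector V x : M -> R (only its values on C matter);
   V(x) in T_x X means it is realized by a curve of X^+ starting at x. *)
Definition vector_field {M : Type} (d : M -> M -> R) (X C : M -> Prop)
    (V : M -> M -> R) : Prop :=
  forall x, X x -> exists phi delta, in_Xplus d X C phi delta /\ phi 0 = x /\
    forall c, C c -> has_fwd_deriv (fun t => d (phi t) c) 0 (V x c).

Definition dCT {M : Type} (d : M -> M -> R) (C : M -> Prop)
    (y : M) (vy : M -> R) (z : M) (vz : M -> R) : R :=
  Rmax (dC d C y z) (supC C (fun c => Rabs (vy c - vz c))).

Definition locally_lipschitz_VF {M : Type} (d : M -> M -> R) (X C : M -> Prop)
    (V : M -> M -> R) : Prop :=
  forall x, X x -> exists r K, 0 < r /\ 0 <= K /\
    forall y z, X y -> X z -> dC d C x y < r -> dC d C x z < r ->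
      dCT d C y (V y) z (V z) <= K * dC d C y z.

Definition is_solution {M : Type} (d : M -> M -> R) (X C : M -> Prop)
    (V : M -> M -> R) (x : M) (sigma : R -> M) (delta : R) : Prop :=
  curve_in d X C sigma delta /\ sigma 0 = x /\
  forall t, 0 <= t < delta -> forall c, C c ->
    has_fwd_deriv (fun s => d (sigma s) c) t (V (sigma t) c).

Definition has_unique_solutions {M : Type} (d : M -> M -> R) (X C : M -> Prop)
    (V : M -> M -> R) : Prop :=
  forall x, X x -> exists sigma delta, is_solution d X C V x sigma delta /\
    forall tau eps, is_solution d X C V x tau eps ->
      forall t, 0 <= t -> t < delta -> t < eps -> tau t = sigma t.

(* Main.v *)
Require Import Defs.
From Stdlib Require Import Reals Lra List Classical IndefiniteDescription.
From Coquelicot Require Import Coquelicot.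
Open Scope R_scope.

(** The tangent condition on [V] holds only coordinate by coordinate, not uniformly in
    [c], so a single Euler step is controlled only in finitely many coordinates [F].
    On a compact set [K], however, finitely many coordinates determine [dC] up to any
    prescribed additive error [e].  Hence, with a lower bound on the step size coming
    again from compactness, Euler polygons controlled in such an [F] stay in a small
    ball up to a fixed time [T], and, when [L * T <= 1/2] for a Lipschitz constant [L]
    of [V], any two of them are within [6 * e] of each other.  Compactness of [K]
    gives their common limit, whose coordinates satisfy
    [|y_c(t+h) - y_c(t) - h V_c(y(t))| <= L B h^2], where [B] bounds [V]; for each [c]
    this is read off polygons for which [c] has been added to [F].  Uniqueness is the
    same contraction estimate for two exact solutions. *)

(** * Bounds on real numbers *)

Lemma le_of_le_add_eps (a b : R) :
  (forall e, 0 < e -> a <= b + e) -> a <= b.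
Proof.
  intros H. destruct (Rle_lt_dec a b) as [h|h]; [exact h|].
  specialize (H ((a - b) / 2)). lra.
Qed.

(** Applied to the least upper bound [m] of [u] on [P], the self-improving estimate reads
    [m <= m / 2 + e]. Contraction arguments thus need no iteration. *)
Lemma halving_bound {T : Type} (P : T -> Prop) (u : T -> R) (A0 e : R) :
  (forall s, P s -> u s <= A0) ->
  (forall A, (forall s, P s -> u s <= A) -> forall s, P s -> u s <= A / 2 + e) ->
  forall s, P s -> u s <= 2 * e.
Proof.
  intros Hb Hh s0 Hs0.
  destruct (completeness (fun v => exists s, P s /\ v = u s)) as [m [Hm1 Hm2]].
  - exists A0. intros v [s [Hs ->]]. auto.
  - exists (u s0), s0. auto.
  - assert (Hm : forall s, P s -> u s <= m) by (intros s Hs; apply Hm1; exists s; auto).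
    assert (m <= m / 2 + e) by (apply Hm2; intros v [s [Hs ->]]; auto).
    specialize (Hm s0 Hs0). lra.
Qed.

(** * Forward derivatives *)

Lemma has_fwd_deriv_unique (f : R -> R) (t l1 l2 : R) :
  has_fwd_deriv f t l1 -> has_fwd_deriv f t l2 -> l1 = l2.
Proof.
  intros H1 H2. apply NNPP. intros Hne.
  assert (He : 0 < Rabs (l1 - l2) / 2) by (assert (0 < Rabs (l1 - l2)) by (apply Rabs_pos_lt; lra); lra).
  destruct (H1 _ He) as [a [Ha H1']]. destruct (H2 _ He) as [b [Hb H2']].
  assert (Hm : 0 < Rmin a b) by (apply Rmin_glb_lt; auto).
  pose proof (Rmin_l a b). pose proof (Rmin_r a b).
  specialize (H1' (Rmin a b / 2)). specialize (H2' (Rmin a b / 2)).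
  set (q := (f (t + Rmin a b / 2) - f t) / (Rmin a b / 2)) in *.
  assert (Rabs (q - l1) < Rabs (l1 - l2) / 2) by (apply H1'; lra).
  assert (Rabs (q - l2) < Rabs (l1 - l2) / 2) by (apply H2'; lra).
  revert H3 H4; unfold Rabs; repeat destruct Rcase_abs; lra.
Qed.

(** Multiplying out the quotient leaves an error [e * h], which adds up linearly over successive
    steps. *)
Lemma has_fwd_deriv_step (f : R -> R) (t l : R) :
  has_fwd_deriv f t l <->
  forall e, 0 < e -> exists eta, 0 < eta /\
    forall h, 0 < h < eta -> Rabs (f (t + h) - f t - h * l) <= e * h.
Proof.
  assert (Hq : forall h, 0 < h ->
    Rabs (f (t + h) - f t - h * l) = h * Rabs ((f (t + h) - f t) / h - l)).
  { intros h Hh. rewrite <- (Rabs_pos_eq h) at 3 by lra. rewrite <- Rabs_mult.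
    f_equal. field. lra. }
  split; intros H e He.
  - destruct (H e He) as [eta [Heta Hs]]. exists eta. split; auto.
    intros h Hh. rewrite Hq by lra. specialize (Hs h Hh). nra.
  - destruct (H (e / 2)) as [eta [Heta Hs]]; [lra|]. exists eta. split; auto.
    intros h Hh. specialize (Hs h Hh). rewrite Hq in Hs by lra.
    assert (Rabs ((f (t + h) - f t) / h - l) <= e / 2) by nra. lra.
Qed.

Lemma has_fwd_deriv_minus (f g : R -> R) (t lf lg : R) :
  has_fwd_deriv f t lf -> has_fwd_deriv g t lg ->
  has_fwd_deriv (fun s => f s - g s) t (lf - lg).
Proof.
  rewrite !has_fwd_deriv_step. intros Hf Hg e He.
  destruct (Hf (e / 2)) as [a [Ha Hf']]; [lra|].
  destruct (Hg (e / 2)) as [b [Hb Hg']]; [lra|].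
  exists (Rmin a b). split; [apply Rmin_glb_lt; auto|].
  intros h Hh. pose proof (Rmin_l a b). pose proof (Rmin_r a b).
  specialize (Hf' h ltac:(lra)). specialize (Hg' h ltac:(lra)).
  apply Rabs_le_between in Hf'. apply Rabs_le_between in Hg'. apply Rabs_le_between. lra.
Qed.

(** A forward derivative sees only values to the right of [t], so curves can be glued at a
    breakpoint. *)
Lemma has_fwd_deriv_ext (f g : R -> R) (t l q : R) :
  t < q -> (forall s, t <= s < q -> f s = g s) ->
  has_fwd_deriv f t l -> has_fwd_deriv g t l.
Proof.
  intros Htq Hfg Hf e He. destruct (Hf e He) as [eta [Heta H]].
  exists (Rmin eta (q - t)). split; [apply Rmin_glb_lt; lra|]. intros h Hh.
  pose proof (Rmin_l eta (q - t)). pose proof (Rmin_r eta (q - t)).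
  rewrite <- !Hfg by lra. apply H. lra.
Qed.

Lemma has_fwd_deriv_affine (a b l t : R) : has_fwd_deriv (fun s => a + (s - b) * l) t l.
Proof.
  apply has_fwd_deriv_step. intros e He. exists 1. split; [lra|]. intros h Hh.
  replace (a + (t + h - b) * l - (a + (t - b) * l) - h * l) with 0 by ring.
  rewrite Rabs_R0. nra.
Qed.

(** Let [m] be the supremum of the points [s] where [f] has moved by at most [(L + e) * (s - a)].
    Continuity puts [m] itself among them, and if [m < b] the forward derivative at [m] produces
    such a point beyond [m]. *)
Lemma fwd_mean_value (f : R -> R) (a b L : R) :
  a <= b ->
  (forall t, a <= t <= b -> forall e, 0 < e -> exists eta, 0 < eta /\
     forall s, a <= s <= b -> Rabs (s - t) < eta -> Rabs (f s - f t) < e) ->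
  (forall t, a <= t < b -> exists l, has_fwd_deriv f t l /\ Rabs l <= L) ->
  Rabs (f b - f a) <= L * (b - a).
Proof.
  intros Hab Hc Hd. apply le_of_le_add_eps. intros e0 He0.
  set (e := e0 / (b - a + 1)).
  assert (He : 0 < e) by (apply Rdiv_lt_0_compat; lra).
  assert (He' : e * (b - a) <= e0).
  { replace e0 with (e * (b - a + 1)) by (unfold e; field; lra). nra. }
  set (S := fun s => a <= s <= b /\ Rabs (f s - f a) <= (L + e) * (s - a)).
  destruct (completeness S) as [m [Hm1 Hm2]].
  - exists b. intros s Hs. apply Hs.
  - exists a. split; [lra|]. rewrite !Rminus_diag, Rabs_R0. lra.
  - assert (Ha : S a) by (split; [lra|]; rewrite !Rminus_diag, Rabs_R0; lra).
    assert (Ham : a <= m) by (apply Hm1; auto).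
    assert (Hmb : m <= b) by (apply Hm2; intros s Hs; apply Hs).
    assert (HSm : S m).
    { split; [lra|]. apply le_of_le_add_eps. intros e1 He1.
      destruct (Hc m ltac:(lra) (e1 / 2)) as [eta [Heta Hcm]]; [lra|].
      (* The second bound makes the change of [(L + e) * s] over a distance [k] at most [e1 / 2];
         the sign of [L + e] is unknown, hence the absolute value. *)
      set (k := Rmin eta (e1 / 2 / (Rabs (L + e) + 1))).
      assert (Hp : 0 < Rabs (L + e) + 1) by (pose proof (Rabs_pos (L + e)); lra).
      assert (Hk0 : 0 < k) by (apply Rmin_glb_lt; auto; apply Rdiv_lt_0_compat; lra).
      assert (Hk1 : k <= eta) by apply Rmin_l.
      assert (Hk2 : k * (Rabs (L + e) + 1) <= e1 / 2).
      { replace (e1 / 2) with (e1 / 2 / (Rabs (L + e) + 1) * (Rabs (L + e) + 1)) by (field; lra).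
        apply Rmult_le_compat_r; [lra|apply Rmin_r]. }
      destruct (classic (exists s, S s /\ m - k < s)) as [[s [Hs Hms]]|Hn].
      - assert (s <= m) by (apply Hm1; auto). destruct Hs as [Hs1 Hs2].
        specialize (Hcm s Hs1 ltac:(apply Rabs_def1; lra)).
        assert (Hle : (L + e) * (s - m) <= e1 / 2).
        { apply Rle_trans with (Rabs (L + e) * (m - s)).
          - pose proof (Rle_abs (- (L + e))). rewrite Rabs_Ropp in H0. nra.
          - pose proof (Rabs_pos (L + e)). nra. }
        apply Rabs_le_between in Hs2. apply Rabs_lt_between in Hcm.
        apply Rabs_le_between. lra.
      - exfalso. assert (m <= m - k); [|lra]. apply Hm2. intros s Hs.
        destruct (Rle_lt_dec s (m - k)); auto. exfalso. apply Hn. exists s. auto. }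
    destruct (Rlt_le_dec m b) as [Hlt|Hge].
    + exfalso. destruct (Hd m ltac:(lra)) as [l [Hl1 Hl2]].
      destruct (proj1 (has_fwd_deriv_step _ _ _) Hl1 e He) as [eta [Heta Hst]].
      set (h := Rmin (eta / 2) (b - m)).
      assert (0 < h) by (apply Rmin_glb_lt; lra).
      assert (h <= eta / 2) by apply Rmin_l. assert (h <= b - m) by apply Rmin_r.
      specialize (Hst h ltac:(lra)). destruct HSm as [_ HSm].
      assert (m + h <= m); [|lra]. apply Hm1. split; [lra|].
      apply Rabs_le_between in Hst. apply Rabs_le_between in HSm. apply Rabs_le_between in Hl2.
      apply Rabs_le_between. nra.
    + assert (m = b) by lra. subst m. destruct HSm as [_ HSm]. lra.
Qed.

Lemma fwd_mean_value_lipschitz (f : R -> R) (a b B L : R) :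
  a <= b -> 0 <= B ->
  (forall s t, a <= s <= b -> a <= t <= b -> Rabs (f s - f t) <= B * Rabs (s - t)) ->
  (forall t, a <= t < b -> exists l, has_fwd_deriv f t l /\ Rabs l <= L) ->
  Rabs (f b - f a) <= L * (b - a).
Proof.
  intros Hab HB Hl. apply fwd_mean_value; auto. intros t Ht e He.
  exists (e / (B + 1)). split; [apply Rdiv_lt_0_compat; lra|]. intros s Hs Hst.
  apply Rle_lt_trans with (1 := Hl s t Hs Ht).
  assert (e / (B + 1) * (B + 1) = e) by (field; lra).
  pose proof (Rabs_pos (s - t)). nra.
Qed.

(** * The metric [dC] *)

(** A common bound [A] keeps the least upper bound finite; [real] would send [p_infty] to 0. *)
Lemma supC_ge {M : Type} (C : M -> Prop) (f : M -> R) (A : R) (c : M) :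
  (forall c, C c -> f c <= A) -> C c -> f c <= supC C f.
Proof.
  intros HA Hc. unfold supC.
  destruct (Lub_Rbar_correct (fun r => exists c, C c /\ r = f c)) as [H1 H2].
  assert (Ha : Rbar_le (f c) (Lub_Rbar (fun r => exists c, C c /\ r = f c)))
    by (apply H1; exists c; auto).
  assert (Hb : Rbar_le (Lub_Rbar (fun r => exists c, C c /\ r = f c)) A)
    by (apply H2; intros r [c' [Hc' ->]]; apply HA; auto).
  destruct (Lub_Rbar (fun r => exists c, C c /\ r = f c)); simpl in *; tauto.
Qed.

(* [0 <= A] is needed because [supC] is [0] when [C] is empty. *)
Lemma supC_le {M : Type} (C : M -> Prop) (f : M -> R) (A : R) :
  0 <= A -> (forall c, C c -> f c <= A) -> supC C f <= A.
Proof.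
  intros H0 HA. unfold supC.
  destruct (Lub_Rbar_correct (fun r => exists c, C c /\ r = f c)) as [H1 H2].
  assert (Hb : Rbar_le (Lub_Rbar (fun r => exists c, C c /\ r = f c)) A)
    by (apply H2; intros r [c' [Hc' ->]]; apply HA; auto).
  destruct (Lub_Rbar (fun r => exists c, C c /\ r = f c)); simpl in *; lra.
Qed.

Lemma dC_le {M : Type} (d : M -> M -> R) (C : M -> Prop) (x y : M) (A : R) :
  0 <= A -> (forall c, C c -> Rabs (d x c - d y c) <= A) -> dC d C x y <= A.
Proof. apply supC_le. Qed.

Lemma coord_le_dC {M : Type} (d : M -> M -> R) (C : M -> Prop) (x y c : M) :
  is_metric d -> C c -> Rabs (d x c - d y c) <= dC d C x y.
Proof.
  intros [_ [Hs Ht]] Hc. unfold dC.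
  apply (supC_ge C (fun c => Rabs (d x c - d y c)) (d x y)); auto.
  intros c' _. pose proof (Ht x y c'). pose proof (Ht y x c'). pose proof (Hs x y).
  apply Rabs_le_between. lra.
Qed.

Lemma dC_pos {M : Type} (d : M -> M -> R) (C : M -> Prop) (x y : M) :
  is_metric d -> 0 <= dC d C x y.
Proof.
  intros Hd. destruct (classic (exists c, C c)) as [[c Hc]|Hn].
  - apply Rle_trans with (2 := coord_le_dC d C x y c Hd Hc). apply Rabs_pos.
  - unfold dC, supC.
    replace (Lub_Rbar (fun r => exists c, C c /\ r = Rabs (d x c - d y c))) with m_infty.
    + simpl. lra.
    + symmetry. apply is_lub_Rbar_unique. split; [|intros; exact I].
      intros r [c [Hc _]]. exfalso. apply Hn. exists c. auto.
Qed.

Lemma dC_refl {M : Type} (d : M -> M -> R) (C : M -> Prop) (x : M) :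
  is_metric d -> dC d C x x = 0.
Proof.
  intros Hd. apply Rle_antisym; [|apply dC_pos; auto].
  apply dC_le; [lra|]. intros c _. rewrite Rminus_diag, Rabs_R0. lra.
Qed.

Lemma dC_sym {M : Type} (d : M -> M -> R) (C : M -> Prop) (x y : M) :
  is_metric d -> dC d C x y = dC d C y x.
Proof.
  intros Hd. apply Rle_antisym; (apply dC_le; [apply dC_pos; auto|]);
    intros c Hc; rewrite Rabs_minus_sym; apply coord_le_dC; auto.
Qed.

Lemma dC_triangle {M : Type} (d : M -> M -> R) (C : M -> Prop) (x y z : M) :
  is_metric d -> dC d C x z <= dC d C x y + dC d C y z.
Proof.
  intros Hd. pose proof (dC_pos d C x y Hd). pose proof (dC_pos d C y z Hd).
  apply dC_le; [lra|]. intros c Hc.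
  pose proof (coord_le_dC d C x y c Hd Hc). pose proof (coord_le_dC d C y z c Hd Hc).
  replace (d x c - d z c) with ((d x c - d y c) + (d y c - d z c)) by ring.
  pose proof (Rabs_triang (d x c - d y c) (d y c - d z c)). lra.
Qed.

Lemma dC_eq0 {M : Type} (d : M -> M -> R) (X C : M -> Prop) (x y : M) :
  is_metric d -> coordinatizing d X C -> X x -> X y -> dC d C x y <= 0 -> x = y.
Proof.
  intros Hd HC Hx Hy H0. apply NNPP. intros Hne.
  destruct (HC x y Hx Hy Hne) as [c [Hc Hdc]].
  pose proof (coord_le_dC d C x y c Hd Hc).
  apply Hdc. apply Rminus_diag_uniq. apply NNPP. intros Hn.
  apply Rabs_pos_lt in Hn. lra.
Qed.

Lemma dC_open_ball {M : Type} (d : M -> M -> R) (X C : M -> Prop) (x : M) (r : R) :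
  is_metric d -> dC_open d X C (fun z => X z /\ dC d C x z < r).
Proof.
  intros Hd. split; [tauto|]. intros y [Hy Hr]. exists (r - dC d C x y). split; [lra|].
  intros z Hz Hyz. split; auto. pose proof (dC_triangle d C x y z Hd). lra.
Qed.

(** Covers by complements of closed balls turn compactness into the finite intersection property. *)
Lemma dC_open_outside {M : Type} (d : M -> M -> R) (X C : M -> Prop) (x : M) (r : R) :
  is_metric d -> dC_open d X C (fun z => X z /\ r < dC d C x z).
Proof.
  intros Hd. split; [tauto|]. intros y [Hy Hr]. exists (dC d C x y - r). split; [lra|].
  intros z Hz Hyz. split; auto. pose proof (dC_triangle d C x z y Hd).
  rewrite (dC_sym d C z y Hd) in H. lra.
Qed.

(** * Vector fields in coordinates *)

Lemma vector_field_bounded {M : Type} (d : M -> M -> R) (X C : M -> Prop) (V : M -> M -> R) :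
  vector_field d X C V ->
  forall x, X x -> exists B, 0 <= B /\ forall c, C c -> Rabs (V x c) <= B.
Proof.
  intros HV x Hx. destruct (HV x Hx) as [phi [dl [[_ [w [Hw [B HB]]]] [_ Hp]]]].
  (* For empty [C] the bound [B] may be negative. *)
  exists (Rmax 0 B). split; [apply Rmax_l|]. intros c Hc.
  rewrite (has_fwd_deriv_unique _ _ _ _ (Hp c Hc) (Hw c Hc)).
  apply Rle_trans with B; [auto|apply Rmax_r].
Qed.

Definition coord_lipschitz {M : Type} (d : M -> M -> R) (X C : M -> Prop)
    (V : M -> M -> R) (x : M) (r K : R) : Prop :=
  forall y z c, X y -> X z -> C c -> dC d C x y < r -> dC d C x z < r ->
    Rabs (V y c - V z c) <= K * dC d C y z.

(** The supremum in [dCT] dominates each coordinate difference because [V y] and [V z] are bounded,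
    so that it is finite. *)
Lemma locally_coord_lipschitz {M : Type} (d : M -> M -> R) (X C : M -> Prop) (V : M -> M -> R) :
  vector_field d X C V -> locally_lipschitz_VF d X C V ->
  forall x, X x -> exists r K, 0 < r /\ 0 <= K /\ coord_lipschitz d X C V x r K.
Proof.
  intros HV HL x Hx. destruct (HL x Hx) as [r [K [Hr [HK H]]]].
  exists r, K. split; [auto|split; [auto|]]. intros y z c Hy Hz Hc Hxy Hxz.
  apply Rle_trans with (2 := H y z Hy Hz Hxy Hxz). unfold dCT.
  apply Rle_trans with (2 := Rmax_r _ _).
  destruct (vector_field_bounded d X C V HV y Hy) as [By [_ HBy]].
  destruct (vector_field_bounded d X C V HV z Hz) as [Bz [_ HBz]].
  apply (supC_ge C (fun c => Rabs (V y c - V z c)) (By + Bz)); auto.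
  intros c' Hc'. specialize (HBy c' Hc'). specialize (HBz c' Hc').
  pose proof (Rabs_triang (V y c') (- V z c')). rewrite Rabs_Ropp in H0.
  unfold Rminus. lra.
Qed.

(** * Compactness *)

(** Finitely many balls, each with a valid scale, cover [K]; by monotonicity of [P] the minimum of
    their scales works everywhere. *)
Lemma compact_uniform_scale {M : Type} (d : M -> M -> R) (X C : M -> Prop) (K : M -> Prop)
    (P : R -> M -> Prop) :
  is_metric d -> dC_compact d X C K ->
  (forall h h' y, 0 < h <= h' -> P h' y -> P h y) ->
  (forall k, X k -> exists r h, 0 < r /\ 0 < h /\ forall y, X y -> dC d C k y < r -> P h y) ->
  exists h, 0 < h /\ forall y, K y -> P h y.
Proof.
  intros Hd [HKX HK] Hmon Hloc.
  (* An index is a ball (centre, radius) known to admit some scale; the scales are extracted only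
     along the finite subcover. *)
  set (I := {i : M * R | exists h, 0 < h /\
    forall y, X y -> dC d C (fst i) y < snd i -> P h y}).
  destruct (HK I (fun i y => X y /\ dC d C (fst (proj1_sig i)) y < snd (proj1_sig i)))
    as [l Hl].
  - intros i. apply dC_open_ball; auto.
  - intros k Hk. destruct (Hloc k (HKX k Hk)) as [r [h [Hr [Hh HP]]]].
    assert (Hi : exists h, 0 < h /\ forall y, X y -> dC d C (fst (k, r)) y < snd (k, r) -> P h y)
      by (exists h; auto).
    exists (exist _ (k, r) Hi). simpl. rewrite dC_refl; auto.
  - assert (Hmin : exists h, 0 < h /\ forall i : I, In i l ->
      forall y, X y -> dC d C (fst (proj1_sig i)) y < snd (proj1_sig i) -> P h y).
    { clear Hl. induction l as [|i l [h [Hh IH]]].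
      - exists 1. split; [lra|]. intros i [].
      - destruct i as [[k r] [h' [Hh' HP]]]. exists (Rmin h h').
        assert (Hm : 0 < Rmin h h') by (apply Rmin_glb_lt; auto).
        split; auto. intros j [<-|Hj] y Hy Hyr.
        + apply Hmon with h'; [split; [auto|apply Rmin_r]|]. apply HP; auto.
        + apply Hmon with h; [split; [auto|apply Rmin_l]|]. apply (IH j); auto. }
    destruct Hmin as [h [Hh HP]]. exists h. split; auto. intros y Hy.
    destruct (Hl y Hy) as [i [Hi [HXy Hiy]]]. apply (HP i); auto.
Qed.

Lemma compact_finite_net {M : Type} (d : M -> M -> R) (X C : M -> Prop) (K : M -> Prop) (e : R) :
  is_metric d -> dC_compact d X C K -> 0 < e ->
  exists l : list M, forall k, K k -> exists z, In z l /\ dC d C z k < e.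
Proof.
  intros Hd [HKX HK] He.
  destruct (HK M (fun z y => X y /\ dC d C z y < e)) as [l Hl].
  - intros z. apply dC_open_ball; auto.
  - intros k Hk. exists k. rewrite dC_refl; auto.
  - exists l. intros k Hk. destruct (Hl k Hk) as [z [Hz [_ Hzk]]]. exists z. auto.
Qed.

Definition resolves {M : Type} (d : M -> M -> R) (C K : M -> Prop) (F : list M) (e : R) : Prop :=
  forall y z A, K y -> K z -> 0 <= A ->
    (forall c, In c F -> Rabs (d y c - d z c) <= A) -> dC d C y z <= A + e.

(** A pair at distance at most [e] needs no coordinate; for any other pair, one coordinate comes
    within [e] of the supremum. *)
Lemma finite_coordinates_for_pairs {M : Type} (d : M -> M -> R) (C : M -> Prop) (e : R)
    (L : list (M * M)) :
  0 < e ->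
  exists F, (forall c, In c F -> C c) /\ forall y z A, In (y, z) L -> 0 <= A ->
    (forall c, In c F -> Rabs (d y c - d z c) <= A) -> dC d C y z <= A + e.
Proof.
  intros He. induction L as [|[a b] L [F [HF IH]]].
  - exists nil. split; [intros c []|]. intros y z A [].
  - destruct (Rle_lt_dec (dC d C a b) e) as [Hle|Hlt].
    + exists F. split; auto. intros y z A [E|Hin] HA Hc; [|apply IH; auto].
      injection E as -> ->. lra.
    + assert (Hex : exists c, C c /\ dC d C a b - e < Rabs (d a c - d b c)).
      { apply NNPP. intros Hn. assert (dC d C a b <= dC d C a b - e); [|lra].
        apply dC_le; [lra|]. intros c Hc.
        destruct (Rle_lt_dec (Rabs (d a c - d b c)) (dC d C a b - e)); auto.
        exfalso. apply Hn. exists c. auto. }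
      destruct Hex as [c0 [Hc0 Hgt]]. exists (c0 :: F). split.
      * intros c [<-|Hc]; auto.
      * intros y z A [E|Hin] HA Hc.
        -- injection E as -> ->. specialize (Hc c0 (or_introl eq_refl)). lra.
        -- apply IH; auto. intros c HcF. apply Hc. right. auto.
Qed.

(** Replacing [y] and [z] by points of an [e / 8]-net costs [e / 4] in the coordinates and [e / 4]
    in [dC]; resolving the pairs of net points costs the remaining [e / 2]. *)
Lemma compact_resolved {M : Type} (d : M -> M -> R) (X C : M -> Prop) (K : M -> Prop) (e : R) :
  is_metric d -> dC_compact d X C K -> 0 < e ->
  exists F, (forall c, In c F -> C c) /\ resolves d C K F e.
Proof.
  intros Hd HK He.
  destruct (compact_finite_net d X C K (e / 8) Hd HK ltac:(lra)) as [l Hl].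
  destruct (finite_coordinates_for_pairs d C (e / 2) (list_prod l l) ltac:(lra)) as [F [HF HFl]].
  exists F. split; auto. intros y z A Hy Hz HA Hc.
  destruct (Hl y Hy) as [a [Ha Hay]]. destruct (Hl z Hz) as [b [Hb Hbz]].
  assert (Hab : dC d C a b <= A + e / 4 + e / 2).
  { apply HFl; [apply in_prod; auto|lra|]. intros c HcF.
    pose proof (coord_le_dC d C a y c Hd (HF c HcF)).
    pose proof (coord_le_dC d C b z c Hd (HF c HcF)).
    specialize (Hc c HcF).
    assert (Rabs (d a c - d y c) <= e / 8) by lra. assert (Rabs (d b c - d z c) <= e / 8) by lra.
    apply Rabs_le_between in H1. apply Rabs_le_between in H2. apply Rabs_le_between in Hc.
    apply Rabs_le_between. lra. }
  pose proof (dC_triangle d C y a z Hd). pose proof (dC_triangle d C a b z Hd).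
  rewrite (dC_sym d C y a Hd) in H. lra.
Qed.

(** * Euler curves *)

(** The target is [phi h] for a curve [phi] representing [V k]. The coordinate derivatives converge
    at different rates, and finiteness of [F] gives a common range for [h]. *)
Lemma curve_small_step {M : Type} (d : M -> M -> R) (X C : M -> Prop) (V : M -> M -> R)
    (F : list M) (k : M) (e : R) :
  vector_field d X C V -> (forall c, In c F -> C c) -> X k -> 0 < e ->
  exists h z, 0 < h <= e /\ X z /\ dC d C z k <= e /\
    forall c, In c F -> Rabs (d z c - d k c - h * V k c) <= e * h.
Proof.
  intros HV HF Hk He.
  destruct (HV k Hk) as [phi [dl [[[Hdl [HX Hc]] _] [H0 Hder]]]].
  destruct (Hc 0 ltac:(lra) e He) as [eta [Heta Hcont]].
  assert (Hall : exists m, 0 < m /\ forall h c, 0 < h < m -> In c F ->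
    Rabs (d (phi h) c - d k c - h * V k c) <= e * h).
  { clear Hcont. induction F as [|c0 F IH].
    - exists 1. split; [lra|]. intros h c _ [].
    - destruct IH as [m [Hm IH]]; [intros c Hc'; apply HF; right; auto|].
      destruct (proj1 (has_fwd_deriv_step _ _ _) (Hder c0 (HF c0 (or_introl eq_refl))) e He)
        as [m0 [Hm0 H1]].
      exists (Rmin m m0). split; [apply Rmin_glb_lt; auto|].
      pose proof (Rmin_l m m0). pose proof (Rmin_r m m0). intros h c Hh [<-|Hin].
      + specialize (H1 h ltac:(lra)). rewrite Rplus_0_l, H0 in H1. auto.
      + apply IH; auto. lra. }
  destruct Hall as [m [Hm Hall]].
  set (h := Rmin (Rmin (m / 2) (dl / 2)) (Rmin (eta / 2) e)).
  assert (Hh : 0 < h) by (repeat apply Rmin_glb_lt; lra).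
  assert (h <= m / 2) by (eapply Rle_trans; apply Rmin_l).
  assert (h <= dl / 2) by (eapply Rle_trans; [apply Rmin_l|apply Rmin_r]).
  assert (h <= eta / 2) by (eapply Rle_trans; [apply Rmin_r|apply Rmin_l]).
  assert (h <= e) by (eapply Rle_trans; [apply Rmin_r|apply Rmin_r]).
  exists h, (phi h). split; [lra|]. split; [apply HX; lra|]. split.
  - rewrite <- H0. left. apply Hcont; [lra|]. rewrite Rminus_0_r, Rabs_pos_eq; lra.
  - intros c Hin. apply Hall; auto. lra.
Qed.

(* The target of a step from [k] also serves for every [y] within distance of
   order [e * h] of [k], so compactness bounds the step size from below. *)
Lemma uniform_euler_step {M : Type} (d : M -> M -> R) (X C : M -> Prop) (V : M -> M -> R)
    (K : M -> Prop) (F : list M) (e : R) :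
  is_metric d -> vector_field d X C V -> locally_lipschitz_VF d X C V ->
  dC_compact d X C K -> (forall c, In c F -> C c) -> 0 < e ->
  exists hmin, 0 < hmin /\ forall y, K y -> exists h z,
    hmin <= h <= e /\ X z /\ dC d C y z <= e /\
    forall c, In c F -> Rabs (d z c - d y c - h * V y c) <= e * h.
Proof.
  intros Hd HV HL HK HF He.
  apply (compact_uniform_scale d X C K (fun hmin y => exists h z,
    hmin <= h <= e /\ X z /\ dC d C y z <= e /\
    forall c, In c F -> Rabs (d z c - d y c - h * V y c) <= e * h)); auto.
  - intros h h' y Hh [h0 [z [H0 H]]]. exists h0, z. split; auto. lra.
  - intros k Hk.
    destruct (locally_coord_lipschitz d X C V HV HL k Hk) as [r [L [Hr [HL0 HLip]]]].
    destruct (curve_small_step d X C V F k (e / 4) HV HF Hk ltac:(lra))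
      as [h [z [Hh [HXz [Hzk Hz]]]]].
    (* In order, the bounds keep [y] in the Lipschitz ball, keep [z] within [e] of [y], limit the
       displacement of the starting coordinates to [e * h / 4], and limit the change of [V] to
       [e / 4]. *)
    set (q := Rmin (Rmin r (e / 2)) (Rmin (e * h / 4) (e / (4 * (L + 1))))).
    assert (Heh : 0 < e * h) by nra.
    assert (Hq : 0 < q) by
      (repeat apply Rmin_glb_lt; try lra; apply Rdiv_lt_0_compat; lra).
    assert (q <= r) by (eapply Rle_trans; apply Rmin_l).
    assert (q <= e / 2) by (eapply Rle_trans; [apply Rmin_l|apply Rmin_r]).
    assert (q <= e * h / 4) by (eapply Rle_trans; [apply Rmin_r|apply Rmin_l]).
    assert (q <= e / (4 * (L + 1))) by (eapply Rle_trans; [apply Rmin_r|apply Rmin_r]).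
    assert (HqL : q * (L + 1) <= e / 4).
    { replace (e / 4) with (e / (4 * (L + 1)) * (L + 1)) by (field; lra).
      apply Rmult_le_compat_r; lra. }
    exists q, h. split; [auto|split; [lra|]]. intros y Hy Hky. exists h, z.
    split; [lra|split; [auto|split]].
    + pose proof (dC_triangle d C y k z Hd).
      rewrite (dC_sym d C y k Hd), (dC_sym d C k z Hd) in H3. lra.
    + intros c Hc. specialize (Hz c Hc).
      pose proof (coord_le_dC d C k y c Hd (HF c Hc)) as H3.
      pose proof (HLip k y c Hk Hy (HF c Hc)) as H4.
      rewrite dC_refl in H4 by auto. specialize (H4 Hr ltac:(lra)).
      pose proof (dC_pos d C k y Hd).
      assert (H6 : Rabs (V k c - V y c) <= e / 4) by nra.
      assert (H7 : Rabs (d k c - d y c) <= e * h / 4) by lra.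
      apply Rabs_le_between in Hz. apply Rabs_le_between in H6. apply Rabs_le_between in H7.
      apply Rabs_le_between. nra.
Qed.

(* [y] is the piecewise constant curve of the nodes of an Euler polygon and [p]
   the piecewise affine curve in [R^C] driven by [V]; the two agree up to [e]
   only in the finitely many coordinates [F]. *)
Definition euler_curve {M : Type} (d : M -> M -> R) (X C : M -> Prop) (V : M -> M -> R)
    (x : M) (r B : R) (F : list M) (e T : R) (y : R -> M) (p : R -> M -> R) : Prop :=
  (forall s, 0 <= s <= T -> X (y s) /\ dC d C x (y s) < r) /\
  (forall c, C c -> p 0 c = d x c) /\
  (forall c s t, C c -> 0 <= s <= T -> 0 <= t <= T ->
     Rabs (p s c - p t c) <= B * Rabs (s - t)) /\
  (forall c s, C c -> 0 <= s < T -> has_fwd_deriv (fun s => p s c) s (V (y s) c)) /\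
  (forall c s, In c F -> 0 <= s <= T -> Rabs (d (y s) c - p s c) <= e).

(** The node stays at [y T] on [[T, T + h)] and jumps to [z] at the end, while [p] continues with
    slope [V (y T)]. Since [y] is constant to the right of each node, the forward derivative of [p]
    is [V (y s)] at breakpoints too. *)
Lemma euler_curve_extend {M : Type} (d : M -> M -> R) (X C : M -> Prop) (V : M -> M -> R)
    (x z : M) (r B : R) (F : list M) (e T h : R) (y : R -> M) (p : R -> M -> R) :
  euler_curve d X C V x r B F e T y p ->
  0 <= T -> 0 < h -> X z -> dC d C x z < r ->
  (forall c, C c -> Rabs (V (y T) c) <= B) ->
  (forall c s, In c F -> 0 <= s <= h -> Rabs (d (y T) c - (p T c + s * V (y T) c)) <= e) ->
  (forall c, In c F -> Rabs (d z c - (p T c + h * V (y T) c)) <= e) ->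
  exists y' p', euler_curve d X C V x r B F e (T + h) y' p' /\ y' (T + h) = z /\
    forall c, p' (T + h) c = p T c + h * V (y T) c.
Proof.
  intros [Hy [Hp0 [HpL [Hpd Hyp]]]] HT Hh HXz Hxz HB Hmid Hend.
  set (y' := fun s => if Rle_dec s T then y s else if Rlt_dec s (T + h) then y T else z).
  set (p' := fun s c => if Rle_dec s T then p s c else p T c + (s - T) * V (y T) c).
  assert (Ey1 : forall s, s <= T -> y' s = y s).
  { intros s Hs. unfold y'. destruct Rle_dec; [auto|lra]. }
  assert (Ey2 : forall s, T <= s < T + h -> y' s = y T).
  { intros s Hs. unfold y'. destruct Rle_dec.
    - replace s with T by lra. auto.
    - destruct Rlt_dec; [auto|lra]. }
  assert (Ey3 : y' (T + h) = z).
  { unfold y'. destruct Rle_dec; [lra|]. destruct Rlt_dec; [lra|auto]. }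
  assert (Ep1 : forall s c, s <= T -> p' s c = p s c).
  { intros s c Hs. unfold p'. destruct Rle_dec; [auto|lra]. }
  assert (Ep2 : forall s c, T <= s -> p' s c = p T c + (s - T) * V (y T) c).
  { intros s c Hs. unfold p'. destruct Rle_dec; [|auto].
    replace s with T by lra. ring. }
  exists y', p'. split; [|split; auto].
  2: { intros c. rewrite Ep2 by lra. ring. }
  assert (Haff : forall c s t, C c -> Rabs ((s - t) * V (y T) c) <= B * Rabs (s - t)).
  { intros c s t Hc. rewrite Rabs_mult, Rmult_comm.
    apply Rmult_le_compat_r; [apply Rabs_pos|auto]. }
  (* An interval that straddles [T] is split there, and the two Lipschitz estimates are added. *)
  assert (Hmono : forall c s t, C c -> 0 <= s <= t -> t <= T + h ->
    Rabs (p' s c - p' t c) <= B * Rabs (s - t)).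
  { intros c s t Hc Hst Ht. destruct (Rle_lt_dec t T) as [HtT|HtT].
    - rewrite !Ep1 by lra. apply HpL; auto; lra.
    - destruct (Rle_lt_dec s T) as [HsT|HsT].
      + rewrite Ep1, Ep2 by lra.
        assert (H1 := HpL c s T Hc ltac:(lra) ltac:(lra)).
        assert (H2 := Haff c t T Hc).
        replace (p s c - (p T c + (t - T) * V (y T) c))
          with ((p s c - p T c) + - ((t - T) * V (y T) c)) by ring.
        apply Rle_trans with (1 := Rabs_triang _ _). rewrite Rabs_Ropp.
        rewrite (Rabs_left1 (s - T)) in H1 by lra. rewrite (Rabs_pos_eq (t - T)) in H2 by lra.
        rewrite (Rabs_left1 (s - t)) by lra. lra.
      + rewrite !Ep2 by lra.
        replace (p T c + (s - T) * V (y T) c - (p T c + (t - T) * V (y T) c))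
          with ((s - t) * V (y T) c) by ring. auto. }
  split; [|split; [|split; [|split]]].
  - intros s Hs. destruct (Rle_lt_dec s T).
    + rewrite Ey1 by lra. apply Hy. lra.
    + destruct (Rlt_le_dec s (T + h)).
      * rewrite Ey2 by lra. apply Hy. lra.
      * replace s with (T + h) by lra. rewrite Ey3. auto.
  - intros c Hc. rewrite Ep1 by lra. auto.
  - intros c s t Hc Hs Ht. destruct (Rle_lt_dec s t).
    + apply Hmono; auto; lra.
    + rewrite Rabs_minus_sym, (Rabs_minus_sym s). apply Hmono; auto; lra.
  - intros c s Hc Hs. destruct (Rlt_le_dec s T).
    + rewrite Ey1 by lra. apply has_fwd_deriv_ext with (fun s => p s c) T; auto.
      * intros s' Hs'. rewrite Ep1 by lra. auto.
      * apply Hpd; auto. lra.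
    + rewrite Ey2 by lra.
      apply has_fwd_deriv_ext with (fun s => p T c + (s - T) * V (y T) c) (s + 1); [lra| |].
      * intros s' Hs'. rewrite Ep2 by lra. auto.
      * apply has_fwd_deriv_affine.
  - intros c s Hc Hs. destruct (Rle_lt_dec s T).
    + rewrite Ey1, Ep1 by lra. apply Hyp; auto. lra.
    + rewrite Ep2 by lra. destruct (Rlt_le_dec s (T + h)).
      * rewrite Ey2 by lra. apply Hmid; auto. lra.
      * replace s with (T + h) by lra. rewrite Ey3.
        replace (T + h - T) with h by ring. auto.
Qed.

(** The last step of a polygon may overshoot the target time, so the polygon is cut back. *)
Lemma euler_curve_restrict {M : Type} (d : M -> M -> R) (X C : M -> Prop) (V : M -> M -> R)
    (x : M) (r B : R) (F : list M) (e T T' : R) (y : R -> M) (p : R -> M -> R) :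
  T <= T' -> euler_curve d X C V x r B F e T' y p -> euler_curve d X C V x r B F e T y p.
Proof.
  intros HT [H1 [H2 [H3 [H4 H5]]]]. split; [|split; [|split; [|split]]]; auto.
  - intros s Hs. apply H1. lra.
  - intros c s t Hc Hs Ht. apply H3; auto; lra.
  - intros c s Hc Hs. apply H4; auto; lra.
  - intros c s Hc Hs. apply H5; auto; lra.
Qed.

Lemma euler_curve_subset {M : Type} (d : M -> M -> R) (X C : M -> Prop) (V : M -> M -> R)
    (x : M) (r B : R) (F G : list M) (e e' T : R) (y : R -> M) (p : R -> M -> R) :
  incl F G -> e' <= e ->
  euler_curve d X C V x r B G e' T y p -> euler_curve d X C V x r B F e T y p.
Proof.
  intros HFG He [H1 [H2 [H3 [H4 H5]]]]. split; [|split; [|split; [|split]]]; auto.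
  intros c s Hc Hs. apply Rle_trans with e'; auto.
Qed.

(** * Euler polygons in a compact ball *)

Definition tame_ball {M : Type} (d : M -> M -> R) (X C : M -> Prop) (V : M -> M -> R)
    (K : M -> Prop) (x : M) (r L B : R) : Prop :=
  dC_compact d X C K /\ X x /\ 0 < r /\ 0 <= L /\ 0 <= B /\
  (forall y, X y -> dC d C x y < r -> K y) /\
  coord_lipschitz d X C V x r L /\
  (forall y c, X y -> dC d C x y < r -> C c -> Rabs (V y c) <= B).

Lemma tame_ball_exists {M : Type} (d : M -> M -> R) (X C : M -> Prop) (V : M -> M -> R) (x : M) :
  is_metric d -> dC_locally_compact d X C -> vector_field d X C V ->
  locally_lipschitz_VF d X C V -> X x ->
  exists K r L B, tame_ball d X C V K x r L B.
Proof.
  intros Hd Hlc HV HL Hx.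
  destruct (Hlc x Hx) as [K [r1 [HK [Hr1 HKr]]]].
  destruct (locally_coord_lipschitz d X C V HV HL x Hx) as [r2 [L [Hr2 [HL0 HLip]]]].
  destruct (vector_field_bounded d X C V HV x Hx) as [B0 [HB0 HB]].
  pose proof (Rmin_l r1 r2). pose proof (Rmin_r r1 r2).
  assert (0 < Rmin r1 r2) by (apply Rmin_glb_lt; auto).
  (* [V] is bounded by [B0] at [x], and the Lipschitz condition adds at most [L * r2] on the
     ball. *)
  exists K, (Rmin r1 r2), L, (B0 + L * r2).
  repeat split; auto; try apply HK.
  - nra.
  - intros y Hy Hxy. apply HKr; auto. lra.
  - intros y z c Hy Hz Hc Hxy Hxz. apply HLip; auto; lra.
  - intros y c Hy Hxy Hc. specialize (HB c Hc).
    assert (H2 := HLip y x c Hy Hx Hc ltac:(lra) ltac:(rewrite dC_refl; auto)).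
    rewrite (dC_sym d C y x Hd) in H2. pose proof (dC_pos d C x y Hd).
    assert (Rabs (V y c - V x c) <= L * r2) by nra.
    replace (V y c) with ((V y c - V x c) + V x c) by ring.
    apply Rle_trans with (1 := Rabs_triang _ _). lra.
Qed.

(* Only the coordinates in [F] are controlled along the polygon; since [F]
   resolves [K] this suffices to keep it inside the ball of radius [r / 2]. *)
Lemma euler_curve_exists {M : Type} (d : M -> M -> R) (X C : M -> Prop) (V : M -> M -> R)
    (K : M -> Prop) (x : M) (r L B : R) (F : list M) (e T : R) :
  is_metric d -> vector_field d X C V -> locally_lipschitz_VF d X C V ->
  tame_ball d X C V K x r L B -> 0 < T -> B * T <= r / 16 ->
  (forall c, In c F -> C c) -> resolves d C K F (r / 16) -> 0 < e <= r / 16 ->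
  exists y p, euler_curve d X C V x (r / 2) B F e T y p.
Proof.
  intros Hd HV HL [HK [Hx [Hr [HL0 [HB0 [HKr [HLip HB]]]]]]] HT HBT HF HFr He.
  (* Steps of length at most [e0 <= 1] start before [T], so the accumulated error [e0 * (t + h)] and
     the drift [h * B] of one step are each at most [e / 2]. The bound [r / 2] puts the next node in
     [K]. *)
  set (e0 := Rmin (Rmin 1 (r / 2)) (e / (2 * (B + T + 1)))).
  assert (He0 : 0 < e0) by
    (repeat apply Rmin_glb_lt; try lra; apply Rdiv_lt_0_compat; lra).
  assert (He1 : e0 <= 1) by (eapply Rle_trans; apply Rmin_l).
  assert (He2 : e0 <= r / 2) by (eapply Rle_trans; [apply Rmin_l|apply Rmin_r]).
  assert (He3 : e0 * (B + T + 1) <= e / 2).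
  { replace (e / 2) with (e / (2 * (B + T + 1)) * (B + T + 1)) by (field; lra).
    apply Rmult_le_compat_r; [lra|apply Rmin_r]. }
  destruct (uniform_euler_step d X C V K F e0 Hd HV HL HK HF He0) as [hmin [Hhmin Hstep]].
  (* The induction carries an error growing linearly in time, which is sharper than the bound [e] of
     [euler_curve]. *)
  set (reach := fun t => exists y p, euler_curve d X C V x (r / 2) B F e t y p /\
    forall c, In c F -> Rabs (d (y t) c - p t c) <= e0 * t).
  assert (Hreach : forall t, 0 <= t < T -> reach t ->
    exists h, hmin <= h <= 1 /\ reach (t + h)).
  { intros t Ht [y [p [He4 Hv]]]. destruct (proj1 He4 t ltac:(lra)) as [HXy Hxy].
    destruct (Hstep (y t)) as [h [z [Hh [HXz [Hyz Hz]]]]]; [apply HKr; auto; lra|].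
    assert (HBy : forall c, C c -> Rabs (V (y t) c) <= B) by (intros c Hc; apply HB; auto; lra).
    assert (Hz2 : forall c, In c F ->
      Rabs (d z c - (p t c + h * V (y t) c)) <= e0 * (t + h)).
    { intros c Hc. specialize (Hv c Hc). specialize (Hz c Hc).
      apply Rabs_le_between in Hv. apply Rabs_le_between in Hz.
      apply Rabs_le_between. lra. }
    assert (Hte : e0 * (t + h) <= e) by nra.
    assert (HhB : h * B <= e / 2) by nra.
    assert (Hxz : dC d C x z < r / 2).
    (* A crude estimate first places [z] in [K]; then [F] resolves. The terms are the error [e] of
       the polygon, its drift up to [t], the drift of the last step, and the cost of resolving. *)
    { assert (dC d C x z <= (e + (r / 16 + e / 2)) + r / 16); [|lra].
      pose proof (dC_triangle d C x (y t) z Hd).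
      apply HFr; [apply HKr; auto; rewrite dC_refl; auto|apply HKr; auto; lra|lra|].
      intros c Hc. specialize (Hz2 c Hc). specialize (HBy c (HF c Hc)).
      destruct He4 as [_ [Hp0 [HpL _]]].
      assert (HpL0 := HpL c t 0 (HF c Hc) ltac:(lra) ltac:(lra)).
      rewrite Hp0, Rminus_0_r, (Rabs_pos_eq t) in HpL0 by (auto; lra).
      assert (Hpx : Rabs (p t c - d x c) <= r / 16) by nra.
      assert (Hz3 : Rabs (d z c - (p t c + h * V (y t) c)) <= e) by lra.
      apply Rabs_le_between in Hz3. apply Rabs_le_between in HBy.
      apply Rabs_le_between in Hpx. apply Rabs_le_between. nra. }
    destruct (euler_curve_extend d X C V x z (r / 2) B F e t h y p)
      as [y' [p' [He5 [Ey Ep]]]]; auto; try lra.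
    - intros c s Hc Hs. specialize (Hv c Hc). specialize (HBy c (HF c Hc)).
      assert (Hv' : Rabs (d (y t) c - p t c) <= e / 2) by nra.
      apply Rabs_le_between in Hv'. apply Rabs_le_between in HBy.
      apply Rabs_le_between. nra.
    - intros c Hc. specialize (Hz2 c Hc). lra.
    - exists h. split; [lra|]. exists y', p'. split; auto.
      intros c Hc. rewrite Ey, Ep. auto. }
  (* Every step lasts at least [hmin], so more than [T / hmin] steps pass the time [T]. *)
  assert (Hit : forall n, exists t, 0 <= t /\ reach t /\ (T <= t \/ INR n * hmin <= t)).
  { induction n as [|n [t [Ht0 [Ht [HtT|Htn]]]]].
    - exists 0. split; [lra|split; [|right; simpl; lra]].
      exists (fun _ => x), (fun _ c => d x c).
      assert (H0 : forall c, Rabs (d x c - d x c) = 0)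
        by (intros c; rewrite Rminus_diag; apply Rabs_R0).
      split; [split; [|split; [|split; [|split]]]|].
      + intros s _. rewrite dC_refl by auto. split; auto; lra.
      + auto.
      + intros c s t _ _ _. rewrite H0. pose proof (Rabs_pos (s - t)). nra.
      + intros c s _ Hs. lra.
      + intros c s _ _. rewrite H0. lra.
      + intros c _. rewrite H0. lra.
    - exists t. auto.
    - destruct (Rle_lt_dec T t) as [HTt|HTt]; [exists t; auto|].
      destruct (Hreach t ltac:(lra) Ht) as [h [Hh Hth]].
      exists (t + h). split; [lra|split; [auto|right]]. rewrite S_INR. lra. }
  destruct (INR_unbounded (T / hmin)) as [n Hn].
  assert (HTn : T < INR n * hmin).
  { replace T with (T / hmin * hmin) by (field; lra). apply Rmult_lt_compat_r; lra. }
  destruct (Hit n) as [t [Ht0 [[y [p [Hy _]]] Hor]]].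
  exists y, p. apply euler_curve_restrict with t; auto. lra.
Qed.

(** If [A] bounds the distance of the nodes, then [p - q] starts at 0 with derivative at most
    [L * A], so it stays below [A / 2]. Passing from [p] and [q] to the nodes costs [2 * e] and
    resolving costs [e]; [halving_bound] turns [A / 2 + 3 * e] into [6 * e]. *)
Lemma euler_curves_close {M : Type} (d : M -> M -> R) (X C : M -> Prop) (V : M -> M -> R)
    (K : M -> Prop) (x : M) (r L B : R) (F : list M) (e T : R)
    (y z : R -> M) (p q : R -> M -> R) :
  is_metric d -> tame_ball d X C V K x r L B -> L * T <= / 2 ->
  (forall c, In c F -> C c) -> resolves d C K F e -> 0 <= e ->
  euler_curve d X C V x (r / 2) B F e T y p ->
  euler_curve d X C V x (r / 2) B F e T z q ->
  forall s, 0 <= s <= T -> dC d C (y s) (z s) <= 6 * e.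
Proof.
  intros Hd [HK [Hx [Hr [HL0 [HB0 [HKr [HLip HB]]]]]]] HLT HF HFr He
    [Hy [Hp0 [HpL [Hpd Hyp]]]] [Hz [Hq0 [HqL [Hqd Hzq]]]] s Hs.
  replace (6 * e) with (2 * (3 * e)) by ring. revert s Hs.
  apply (halving_bound (fun s => 0 <= s <= T) (fun s => dC d C (y s) (z s)) r).
  - intros s Hs. pose proof (dC_triangle d C (y s) x (z s) Hd).
    rewrite (dC_sym d C (y s) x Hd) in H.
    pose proof (proj2 (Hy s Hs)). pose proof (proj2 (Hz s Hs)). lra.
  - intros A HA s Hs. destruct (Hy s Hs) as [HXy Hxy]. destruct (Hz s Hs) as [HXz Hxz].
    assert (HA0 : 0 <= A) by (apply Rle_trans with (2 := HA s Hs); apply dC_pos; auto).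
    replace (A / 2 + 3 * e) with ((A / 2 + 2 * e) + e) by ring.
    apply HFr; [apply HKr; auto; lra|apply HKr; auto; lra|lra|].
    intros c Hc. pose proof (HF c Hc) as HCc.
    assert (Hpq : Rabs (p s c - q s c) <= A / 2).
    { assert (Hmv : Rabs ((p s c - q s c) - (p 0 c - q 0 c)) <= L * A * (s - 0)).
      { apply (fwd_mean_value_lipschitz (fun s => p s c - q s c) 0 s (2 * B)); try lra.
        - intros a b Ha Hb.
          pose proof (HpL c a b HCc ltac:(lra) ltac:(lra)).
          pose proof (HqL c a b HCc ltac:(lra) ltac:(lra)).
          replace (p a c - q a c - (p b c - q b c))
            with ((p a c - p b c) - (q a c - q b c)) by ring.
          apply Rle_trans with (1 := Rabs_triang _ _). rewrite Rabs_Ropp. lra.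
        - intros t Ht. exists (V (y t) c - V (z t) c). split.
          + apply has_fwd_deriv_minus; [apply Hpd|apply Hqd]; auto; lra.
          + destruct (Hy t ltac:(lra)). destruct (Hz t ltac:(lra)).
            apply Rle_trans with (L * dC d C (y t) (z t)); [apply HLip; auto; lra|].
            apply Rmult_le_compat_l; auto. apply HA. lra. }
      rewrite Hp0, Hq0, Rminus_diag, !Rminus_0_r in Hmv by auto.
      apply Rle_trans with (1 := Hmv).
      assert (L * s <= L * T) by nra. nra. }
    specialize (Hyp c s Hc Hs). specialize (Hzq c s Hc Hs).
    apply Rabs_le_between in Hyp. apply Rabs_le_between in Hzq.
    apply Rabs_le_between in Hpq. apply Rabs_le_between. lra.
Qed.

Lemma resolves_weaken {M : Type} (d : M -> M -> R) (C K : M -> Prop) (F G : list M) (e e' : R) :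
  incl F G -> e <= e' -> resolves d C K F e -> resolves d C K G e'.
Proof.
  intros HFG He HF y z A Hy Hz HA Hc. apply Rle_trans with (A + e); [|lra].
  apply HF; auto.
Qed.

(** * Existence *)

(* At a fixed time the closed balls [dC (z t) _ <= 6 * e], over all Euler curves
   [z], have the finite intersection property in [K]. *)
Lemma euler_limit_point {M : Type} (d : M -> M -> R) (X C : M -> Prop) (V : M -> M -> R)
    (K : M -> Prop) (x : M) (r L B T t : R) :
  is_metric d -> vector_field d X C V -> locally_lipschitz_VF d X C V ->
  tame_ball d X C V K x r L B -> 0 < T -> B * T <= r / 16 -> L * T <= / 2 -> 0 <= t <= T ->
  exists w, X w /\ forall e F z p, 0 < e -> (forall c, In c F -> C c) -> resolves d C K F e ->
    euler_curve d X C V x (r / 2) B F e T z p -> dC d C (z t) w <= 6 * e.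
Proof.
  intros Hd HV HL Htame HT HBT HLT Ht.
  pose proof Htame as [HK [Hx [Hr [HL0 [HB0 [HKr _]]]]]].
  set (I := {i : R * list M * (R -> M) | 0 < fst (fst i) /\
    (forall c, In c (snd (fst i)) -> C c) /\ resolves d C K (snd (fst i)) (fst (fst i)) /\
    exists p, euler_curve d X C V x (r / 2) B (snd (fst i)) (fst (fst i)) T (snd i) p}).
  apply NNPP. intros Hno.
  (* If no point of [K] lies in all the closed balls, their complements cover [K]. *)
  destruct (proj2 HK I (fun i w => X w /\
    6 * fst (fst (proj1_sig i)) < dC d C (snd (proj1_sig i) t) w)) as [l Hl].
  - intros i. apply dC_open_outside; auto.
  - intros k Hk. apply NNPP. intros Hn. apply Hno. exists k.
    pose proof (proj1 HK k Hk) as HXk. split; auto. intros e F z p He HF HFr Hz.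
    destruct (Rle_lt_dec (dC d C (z t) k) (6 * e)) as [h|h]; auto. exfalso. apply Hn.
    assert (Hi : 0 < fst (fst (e, F, z)) /\
      (forall c, In c (snd (fst (e, F, z))) -> C c) /\
      resolves d C K (snd (fst (e, F, z))) (fst (fst (e, F, z))) /\
      exists p, euler_curve d X C V x (r / 2) B (snd (fst (e, F, z))) (fst (fst (e, F, z)))
        T (snd (e, F, z)) p) by (simpl; repeat split; auto; exists p; auto).
    exists (exist _ (e, F, z) Hi). simpl. auto.
  (* A polygon controlled in all the coordinate lists of the subcover, with the smallest of its
     errors, is comparable with each polygon there. Resolution [r / 16] is what its existence
     requires. *)
  - assert (Hfin : exists G e, 0 < e <= r / 16 /\ (forall c, In c G -> C c) /\
      resolves d C K G (r / 16) /\ forall i : I, In i l ->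
      incl (snd (fst (proj1_sig i))) G /\ e <= fst (fst (proj1_sig i))).
    { clear Hl. induction l as [|i l [G [e [He [HG [HGr IH]]]]]].
      - destruct (compact_resolved d X C K (r / 16) Hd HK ltac:(lra)) as [G [HG HGr]].
        exists G, (r / 16). split; [lra|split; [auto|split; [auto|]]]. intros i [].
      - pose proof (proj2_sig i) as [Hi1 [Hi2 _]].
        set (ei := fst (fst (proj1_sig i))) in *. set (Fi := snd (fst (proj1_sig i))) in *.
        exists (Fi ++ G), (Rmin e ei).
        pose proof (Rmin_l e ei). pose proof (Rmin_r e ei).
        assert (0 < Rmin e ei) by (apply Rmin_glb_lt; lra).
        split; [lra|split; [|split]].
        + intros c Hc. apply in_app_or in Hc. destruct Hc; auto.
        + apply resolves_weaken with G (r / 16); auto; [apply incl_appr, incl_refl|lra].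
        + intros j [<-|Hj].
          * split; auto. apply incl_appl, incl_refl.
          * destruct (IH j Hj). split; [apply incl_appr; auto|lra]. }
    destruct Hfin as [G [e [He [HG [HGr Hfin]]]]].
    destruct (euler_curve_exists d X C V K x r L B G e T) as [y [p Hy]]; auto.
    destruct (proj1 Hy t Ht) as [HXy Hxy].
    destruct (Hl (y t)) as [i [Hi [_ Hiy]]]; [apply HKr; auto; lra|].
    destruct (Hfin i Hi) as [Hinc Hei]. destruct (proj2_sig i) as [Hi1 [Hi2 [Hi3 [q Hq]]]].
    assert (dC d C (snd (proj1_sig i) t) (y t) <= 6 * fst (fst (proj1_sig i))); [|lra].
    apply (euler_curves_close d X C V K x r L B (snd (fst (proj1_sig i))) _ T _ _ q p);
      auto; [lra|].
    apply euler_curve_subset with G e; auto.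
Qed.

Lemma solution_exists {M : Type} (d : M -> M -> R) (X C : M -> Prop) (V : M -> M -> R) (x : M) :
  is_metric d -> coordinatizing d X C -> dC_locally_compact d X C ->
  vector_field d X C V -> locally_lipschitz_VF d X C V -> X x ->
  exists sigma delta, is_solution d X C V x sigma delta.
Proof.
  intros Hd HC Hlc HV HL Hx.
  destruct (tame_ball_exists d X C V x Hd Hlc HV HL Hx) as [K [r [L [B Htame]]]].
  pose proof Htame as [HK [_ [Hr [HL0 [HB0 [HKr [HLip HB]]]]]]].
  (* The two bounds give [B * T <= r / 16] for existence of polygons and [L * T <= / 2] for the
     contraction; adding 1 avoids division by zero. *)
  set (T := Rmin (r / (16 * (B + 1))) (/ (2 * (L + 1)))).
  assert (HT : 0 < T).
  { apply Rmin_glb_lt; [apply Rdiv_lt_0_compat; lra|apply Rinv_0_lt_compat; lra]. }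
  assert (HBT : B * T <= r / 16).
  { apply Rle_trans with ((B + 1) * T); [nra|].
    replace (r / 16) with ((B + 1) * (r / (16 * (B + 1)))) by (field; lra).
    apply Rmult_le_compat_l; [lra|apply Rmin_l]. }
  assert (HLT : L * T <= / 2).
  { apply Rle_trans with ((L + 1) * T); [nra|].
    replace (/ 2) with ((L + 1) * (/ (2 * (L + 1)))) by (field; lra).
    apply Rmult_le_compat_l; [lra|apply Rmin_r]. }
  (* The limit is chosen at each time separately, with [x] as a placeholder outside [[0, T]].
     Coherence in time comes from each single polygon being close to [y] at all times. *)
  destruct (functional_choice (fun t w => 0 <= t <= T -> X w /\
    forall e F z p, 0 < e -> (forall c, In c F -> C c) -> resolves d C K F e ->
    euler_curve d X C V x (r / 2) B F e T z p -> dC d C (z t) w <= 6 * e)) as [y Hy].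
  { intros t. destruct (classic (0 <= t <= T)) as [Ht|Ht].
    - destruct (euler_limit_point d X C V K x r L B T t) as [w Hw]; auto. exists w. auto.
    - exists x. tauto. }
  assert (Happ : forall c e, C c -> 0 < e -> exists F z p, In c F /\
    euler_curve d X C V x (r / 2) B F e T z p /\
    forall t, 0 <= t <= T -> dC d C (z t) (y t) <= 6 * e).
  { intros c e Hc He. set (e' := Rmin e (r / 16)).
    assert (He' : 0 < e') by (apply Rmin_glb_lt; lra).
    assert (e' <= e) by apply Rmin_l. assert (e' <= r / 16) by apply Rmin_r.
    destruct (compact_resolved d X C K e' Hd HK He') as [F [HF HFr]].
    assert (HcF : forall a, In a (c :: F) -> C a) by (intros a [<-|Ha]; auto).
    assert (Hinc : incl F (c :: F)) by apply incl_tl, incl_refl.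
    assert (HFr' : resolves d C K (c :: F) e') by (apply resolves_weaken with F e'; auto; lra).
    destruct (euler_curve_exists d X C V K x r L B (c :: F) e' T) as [z [p Hz]]; auto.
    { apply resolves_weaken with F e'; auto. }
    exists (c :: F), z, p. split; [left; auto|split].
    - apply euler_curve_subset with (c :: F) e'; auto. apply incl_refl.
    - intros t Ht. apply Rle_trans with (6 * e'); [|lra].
      apply (proj2 (Hy t Ht) e' (c :: F) z p); auto. }
  assert (HX : forall t, 0 <= t <= T -> X (y t)) by (intros t Ht; apply Hy; auto).
  assert (Hball : forall t, 0 <= t <= T -> dC d C x (y t) < r).
  { intros t Ht. destruct (classic (exists c, C c)) as [[c Hc]|Hn].
    - destruct (Happ c (r / 24) Hc ltac:(lra)) as [F [z [p [_ [Hz Hzy]]]]].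
      pose proof (proj2 (proj1 Hz t Ht)). specialize (Hzy t Ht).
      pose proof (dC_triangle d C x (z t) (y t) Hd). lra.
    - apply Rle_lt_trans with 0; auto. apply dC_le; [lra|].
      intros c Hc. exfalso. apply Hn. exists c. auto. }
  (* The error [7 * e] is [6 * e] from [y] to the nodes and [e] from the nodes to [p], as [c] is in
     [F]. *)
  assert (Hcoord : forall c e, C c -> 0 < e -> exists F z p, In c F /\
    euler_curve d X C V x (r / 2) B F e T z p /\
    (forall t, 0 <= t <= T -> dC d C (z t) (y t) <= 6 * e) /\
    forall t, 0 <= t <= T -> Rabs (d (y t) c - p t c) <= 7 * e).
  { intros c e Hc He. destruct (Happ c e Hc He) as [F [z [p [HcF [Hz Hzy]]]]].
    exists F, z, p. split; [auto|split; [auto|split; [auto|]]]. intros t Ht.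
    pose proof (proj2 (proj2 (proj2 (proj2 Hz))) c t HcF Ht) as H1.
    pose proof (coord_le_dC d C (z t) (y t) c Hd Hc) as H2. specialize (Hzy t Ht).
    assert (H3 : Rabs (d (z t) c - d (y t) c) <= 6 * e) by lra.
    apply Rabs_le_between in H1. apply Rabs_le_between in H3. apply Rabs_le_between. lra. }
  assert (Hlip : forall s t, 0 <= s <= T -> 0 <= t <= T ->
    dC d C (y s) (y t) <= B * Rabs (s - t)).
  { intros s t Hs Ht. pose proof (Rabs_pos (s - t)).
    apply dC_le; [nra|]. intros c Hc. apply le_of_le_add_eps. intros e He.
    destruct (Hcoord c (e / 14) Hc ltac:(lra)) as [F [z [p [_ [Hz [_ Hyp]]]]]].
    pose proof (Hyp s Hs) as H1. pose proof (Hyp t Ht) as H2.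
    pose proof (proj1 (proj2 (proj2 Hz)) c s t Hc Hs Ht) as H3.
    apply Rabs_le_between in H1. apply Rabs_le_between in H2. apply Rabs_le_between in H3.
    apply Rabs_le_between. lra. }
  assert (Hy0 : y 0 = x).
  { apply (dC_eq0 d X C); auto; [apply HX; lra|]. apply dC_le; [lra|].
    intros c Hc. apply le_of_le_add_eps. intros e He.
    destruct (Hcoord c (e / 7) Hc ltac:(lra)) as [F [z [p [_ [Hz [_ Hyp]]]]]].
    specialize (Hyp 0 ltac:(lra)). rewrite (proj1 (proj2 Hz) c Hc) in Hyp. lra. }
  (* The remainder is quadratic, uniformly in [c]. *)
  assert (Hquad : forall c t h, C c -> 0 <= t -> 0 < h -> t + h <= T ->
    Rabs (d (y (t + h)) c - d (y t) c - h * V (y t) c) <= L * B * h * h).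
  { intros c t h Hc Ht Hh HtT. apply le_of_le_add_eps. intros e He.
    (* The denominator collects [7 * e'] at each of the two endpoints and [6 * L * h * e'] from
       comparing [z] with [y] inside [V]. *)
    set (e' := e / (14 + 6 * L * h)).
    assert (HLh : 0 <= L * h) by nra.
    assert (He' : 0 < e') by (apply Rdiv_lt_0_compat; lra).
    assert (Ee : e = e' * (14 + 6 * L * h)) by (unfold e'; field; lra).
    destruct (Hcoord c e' Hc He') as [F [z [p [_ [Hz [Hzy Hyp]]]]]].
    destruct Hz as [Hz [_ [HpL [Hpd _]]]].
    set (v := V (y t) c).
    (* The mean value estimate is applied to [p] minus its affine approximation of slope [v]. For
       [s] in the interval, [z s] is within [6 * e' + B * h] of [y t]. *)
    assert (Hmv : Rabs ((p (t + h) c - (p t c + (t + h - t) * v)) - (p t c - (p t c + (t - t) * v)))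
      <= L * (6 * e' + B * h) * (t + h - t)).
    { apply (fwd_mean_value_lipschitz (fun s => p s c - (p t c + (s - t) * v))
        t (t + h) (B + Rabs v)); [lra|pose proof (Rabs_pos v); lra| |].
      - intros a b Ha Hb. pose proof (HpL c a b Hc ltac:(lra) ltac:(lra)).
        replace (p a c - (p t c + (a - t) * v) - (p b c - (p t c + (b - t) * v)))
          with ((p a c - p b c) - v * (a - b)) by ring.
        apply Rle_trans with (1 := Rabs_triang _ _). rewrite Rabs_Ropp, Rabs_mult. lra.
      - intros s Hs. exists (V (z s) c - v). split.
        + apply has_fwd_deriv_minus; [apply Hpd; auto; lra|apply has_fwd_deriv_affine].
        + destruct (Hz s ltac:(lra)).
          apply Rle_trans with (L * dC d C (z s) (y t)).
          * apply HLip; auto; [apply HX; lra|lra|apply Hball; lra].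
          * apply Rmult_le_compat_l; auto.
            pose proof (dC_triangle d C (z s) (y s) (y t) Hd).
            pose proof (Hzy s ltac:(lra)).
            pose proof (Hlip s t ltac:(lra) ltac:(lra)) as Hst.
            rewrite Rabs_pos_eq in Hst by lra. nra. }
    replace (p (t + h) c - (p t c + (t + h - t) * v) - (p t c - (p t c + (t - t) * v)))
      with (p (t + h) c - p t c - h * v) in Hmv by ring.
    replace (L * (6 * e' + B * h) * (t + h - t))
      with (L * B * h * h + e' * (6 * L * h)) in Hmv by ring.
    pose proof (Hyp t ltac:(lra)) as H1. pose proof (Hyp (t + h) ltac:(lra)) as H2.
    apply Rabs_le_between in H1. apply Rabs_le_between in H2. apply Rabs_le_between in Hmv.
    apply Rabs_le_between. fold v. lra. }
  exists y, T. split; [split; [auto|split]|split; auto].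
  - intros t Ht. apply HX. lra.
  - intros t Ht e He. exists (e / (B + 1)). split; [apply Rdiv_lt_0_compat; lra|].
    intros s Hs Hst. apply Rle_lt_trans with (1 := Hlip s t ltac:(lra) ltac:(lra)).
    assert (e / (B + 1) * (B + 1) = e) by (field; lra).
    pose proof (Rabs_pos (s - t)). nra.
  - intros t Ht c Hc. apply has_fwd_deriv_step. intros e He.
    assert (HLB : 0 <= L * B) by nra.
    exists (Rmin (T - t) (e / (L * B + 1))).
    split; [apply Rmin_glb_lt; [lra|apply Rdiv_lt_0_compat; lra]|]. intros h Hh.
    pose proof (Rmin_l (T - t) (e / (L * B + 1))). pose proof (Rmin_r (T - t) (e / (L * B + 1))).
    apply Rle_trans with (1 := Hquad c t h Hc ltac:(lra) ltac:(lra) ltac:(lra)).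
    assert (e / (L * B + 1) * (L * B + 1) = e) by (field; lra).
    apply Rmult_le_compat_r; [lra|]. nra.
Qed.

(** * Uniqueness *)

Lemma curve_coord_continuous {M : Type} (d : M -> M -> R) (X C : M -> Prop)
    (phi : R -> M) (delta : R) (c : M) :
  is_metric d -> curve_in d X C phi delta -> C c ->
  forall t, 0 <= t < delta -> forall e, 0 < e -> exists eta, 0 < eta /\
    forall s, 0 <= s < delta -> Rabs (s - t) < eta -> Rabs (d (phi s) c - d (phi t) c) < e.
Proof.
  intros Hd [_ [_ Hc]] HCc t Ht e He. destruct (Hc t Ht e He) as [eta [Heta H]].
  exists eta. split; auto. intros s Hs Hst.
  apply Rle_lt_trans with (2 := H s Hs Hst). apply coord_le_dC; auto.
Qed.

(** On a time interval of length at most [/ (2 * (L + 1))], a bound [A] on the distance of the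
    solutions improves to [A / 2], so the distance is 0. *)
Lemma solutions_agree_locally {M : Type} (d : M -> M -> R) (X C : M -> Prop) (V : M -> M -> R)
    (x x' : M) (sigma tau : R -> M) (delta eps t0 : R) :
  is_metric d -> coordinatizing d X C -> vector_field d X C V ->
  locally_lipschitz_VF d X C V ->
  is_solution d X C V x sigma delta -> is_solution d X C V x' tau eps ->
  0 <= t0 -> t0 < delta -> t0 < eps -> sigma t0 = tau t0 ->
  exists eta, 0 < eta /\
    forall t, t0 <= t <= t0 + eta -> t < delta -> t < eps -> sigma t = tau t.
Proof.
  intros Hd HC HV HL [Hsc [_ Hsd]] [Htc [_ Htd]] H0 H1 H2 Heq.
  pose proof Hsc as [_ [HsX Hs]]. pose proof Htc as [_ [HtX Ht]].
  destruct (locally_coord_lipschitz d X C V HV HL (sigma t0) (HsX t0 ltac:(lra)))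
    as [r [L [Hr [HL0 HLip]]]].
  destruct (Hs t0 ltac:(lra) r Hr) as [e1 [He1 Hs1]].
  destruct (Ht t0 ltac:(lra) r Hr) as [e2 [He2 Ht1]].
  set (q := / (2 * (L + 1))). assert (Hq : 0 < q) by (apply Rinv_0_lt_compat; lra).
  assert (HLq : L * q <= / 2).
  { apply Rle_trans with ((L + 1) * q); [nra|]. right. unfold q. field. lra. }
  set (eta := Rmin q (Rmin (e1 / 2) (e2 / 2))).
  assert (Heta : 0 < eta) by (repeat apply Rmin_glb_lt; lra).
  assert (eta <= q) by apply Rmin_l.
  assert (eta <= e1 / 2) by (eapply Rle_trans; [apply Rmin_r|apply Rmin_l]).
  assert (eta <= e2 / 2) by (eapply Rle_trans; [apply Rmin_r|apply Rmin_r]).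
  exists eta. split; auto. intros t1 Ht01 Htd1 Hte1.
  assert (Hnear : forall t, t0 <= t <= t1 ->
    dC d C (sigma t0) (sigma t) < r /\ dC d C (sigma t0) (tau t) < r).
  { intros t Htt. split.
    - rewrite dC_sym by auto. apply Hs1; [lra|]. rewrite Rabs_pos_eq; lra.
    - rewrite dC_sym, Heq by auto. apply Ht1; [lra|]. rewrite Rabs_pos_eq; lra. }
  apply (dC_eq0 d X C); auto; [apply HsX; lra|apply HtX; lra|].
  (* This is [halving_bound] with [e = 0]. *)
  replace 0 with (2 * 0) by ring.
  apply (halving_bound (fun t => t0 <= t <= t1) (fun t => dC d C (sigma t) (tau t)) (2 * r));
    [| |lra].
  - intros t Htt. destruct (Hnear t Htt).
    pose proof (dC_triangle d C (sigma t) (sigma t0) (tau t) Hd) as H8.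
    rewrite (dC_sym d C (sigma t) (sigma t0) Hd) in H8. lra.
  - intros A HA t Htt.
    assert (HA0 : 0 <= A) by (apply Rle_trans with (2 := HA t Htt); apply dC_pos; auto).
    apply dC_le; [lra|]. intros c Hc.
    assert (Hmv : Rabs ((d (sigma t) c - d (tau t) c) - (d (sigma t0) c - d (tau t0) c))
      <= L * A * (t - t0)).
    { apply (fwd_mean_value (fun s => d (sigma s) c - d (tau s) c)); [lra| |].
      - intros s Hss e He.
        destruct (curve_coord_continuous d X C sigma delta c Hd Hsc Hc s ltac:(lra) (e / 2))
          as [a [Ha Hsa]]; [lra|].
        destruct (curve_coord_continuous d X C tau eps c Hd Htc Hc s ltac:(lra) (e / 2))
          as [b [Hb Htb]]; [lra|].
        exists (Rmin a b). split; [apply Rmin_glb_lt; auto|].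
        pose proof (Rmin_l a b). pose proof (Rmin_r a b). intros u Hu Hus.
        specialize (Hsa u ltac:(lra) ltac:(lra)). specialize (Htb u ltac:(lra) ltac:(lra)).
        apply Rabs_lt_between in Hsa. apply Rabs_lt_between in Htb.
        apply Rabs_lt_between. lra.
      - intros s Hss. exists (V (sigma s) c - V (tau s) c). split.
        + apply has_fwd_deriv_minus; [apply Hsd|apply Htd]; auto; lra.
        + destruct (Hnear s ltac:(lra)).
          apply Rle_trans with (L * dC d C (sigma s) (tau s)).
          * apply HLip; auto; [apply HsX; lra|apply HtX; lra].
          * apply Rmult_le_compat_l; auto. apply HA. lra. }
    rewrite Heq, Rminus_diag, Rminus_0_r in Hmv.
    apply Rle_trans with (1 := Hmv).
    assert (L * (t - t0) <= / 2) by nra. nra.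
Qed.

(** Let [m] be the supremum of the times up to which the solutions agree. They agree before [m], at
    [m] by continuity, and shortly after [m] by local agreement, which forces [m = t1]. *)
Lemma solutions_agree {M : Type} (d : M -> M -> R) (X C : M -> Prop) (V : M -> M -> R)
    (x : M) (sigma tau : R -> M) (delta eps : R) :
  is_metric d -> coordinatizing d X C -> vector_field d X C V ->
  locally_lipschitz_VF d X C V ->
  is_solution d X C V x sigma delta -> is_solution d X C V x tau eps ->
  forall t, 0 <= t -> t < delta -> t < eps -> sigma t = tau t.
Proof.
  intros Hd HC HV HL Hsig Htau t1 H0 H1 H2.
  set (S := fun t => 0 <= t <= t1 /\ forall s, 0 <= s <= t -> sigma s = tau s).
  assert (HS0 : S 0).
  { split; [lra|]. intros s Hs. replace s with 0 by lra.
    rewrite (proj1 (proj2 Hsig)), (proj1 (proj2 Htau)). auto. }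
  destruct (completeness S) as [m [Hm1 Hm2]].
  - exists t1. intros s Hs. apply Hs.
  - exists 0. auto.
  - assert (H0m : 0 <= m) by (apply Hm1; auto).
    assert (Hmt : m <= t1) by (apply Hm2; intros s Hs; apply Hs).
    assert (Hbelow : forall s, 0 <= s < m -> sigma s = tau s).
    { intros s Hs. apply NNPP. intros Hne. assert (m <= s); [|lra].
      apply Hm2. intros u [Hu1 Hu2]. destruct (Rle_lt_dec u s); auto.
      exfalso. apply Hne. apply Hu2. lra. }
    assert (Heqm : sigma m = tau m).
    (* At [m = 0] there are no earlier times to approximate from, and the common initial condition
       is used. *)
    { destruct (Req_dec m 0) as [->|Hm0]; [apply HS0; lra|].
      pose proof Hsig as [[_ [HsX Hs]] _]. pose proof Htau as [[_ [HtX Ht]] _].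
      apply (dC_eq0 d X C); auto; [apply HsX; lra|apply HtX; lra|].
      apply le_of_le_add_eps. intros e He.
      destruct (Hs m ltac:(lra) (e / 2)) as [a [Ha Hsa]]; [lra|].
      destruct (Ht m ltac:(lra) (e / 2)) as [b [Hb Htb]]; [lra|].
      set (k := Rmin m (Rmin a b) / 2).
      assert (0 < Rmin m (Rmin a b)) by (repeat apply Rmin_glb_lt; lra).
      assert (Rmin m (Rmin a b) <= m) by apply Rmin_l.
      assert (Rmin m (Rmin a b) <= a) by (eapply Rle_trans; [apply Rmin_r|apply Rmin_l]).
      assert (Rmin m (Rmin a b) <= b) by (eapply Rle_trans; [apply Rmin_r|apply Rmin_r]).
      assert (Hk : 0 < k < m /\ k < a /\ k < b) by (unfold k; lra).
      specialize (Hsa (m - k) ltac:(lra) ltac:(apply Rabs_def1; lra)).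
      specialize (Htb (m - k) ltac:(lra) ltac:(apply Rabs_def1; lra)).
      rewrite Hbelow in Hsa by lra.
      pose proof (dC_triangle d C (sigma m) (tau (m - k)) (tau m) Hd) as H7.
      rewrite (dC_sym d C (sigma m) (tau (m - k)) Hd) in H7. lra. }
    destruct (Req_dec m t1) as [<-|Hne]; auto. exfalso.
    destruct (solutions_agree_locally d X C V x x sigma tau delta eps m)
      as [eta [Heta Hloc]]; auto; try lra.
    set (h := Rmin eta (t1 - m)).
    assert (0 < h) by (apply Rmin_glb_lt; lra).
    assert (h <= eta) by apply Rmin_l. assert (h <= t1 - m) by apply Rmin_r.
    assert (m + h <= m); [|lra]. apply Hm1. split; [lra|]. intros s Hs.
    destruct (Rlt_le_dec s m); [apply Hbelow; lra|apply Hloc; lra].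
Qed.

Theorem theorem6p1 (M : Type) (d : M -> M -> R) (X C : M -> Prop)
  (V : M -> M -> R)
  (Hd : is_metric d) (HC : coordinatizing d X C)
  (Hlc : dC_locally_compact d X C)
  (HV : vector_field d X C V)
  (HL : locally_lipschitz_VF d X C V) :
  has_unique_solutions d X C V.
Proof.
  intros x Hx. destruct (solution_exists d X C V x Hd HC Hlc HV HL Hx) as [sigma [delta Hsig]].
  exists sigma, delta. split; auto. intros tau eps Htau t H0 H1 H2. symmetry.
  apply (solutions_agree d X C V x sigma tau delta eps); auto.
Qed.
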